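(* (Dual Orlicz-Aleksandrov-Fenchel inequality) Let $L_1,K_1,\ldots,K_n\in\mathcal S^n$, let $1\le r\le n$, and let $\phi\in\mathcal C$. Then $$\widetilde V_\phi(L_1,K_1,K_2,\ldots,K_n)\ \ge\ \widetilde V(L_1,K_2,\ldots,K_n)\,\phi\left(\frac{\prod_{i=1}^{r}\widetilde V(\underbrace{K_i,\ldots,K_i}_{r},K_{r+1},\ldots,K_n)^{1/r}}{\widetilde V(L_1,K_2,\ldots,K_n)}\right).$$ If $\phi$ is strictly convex, equality holds if and only if $L_1,K_1,\ldots,K_r$ are all dilates of each other.
   Context: $\mathcal S^n$ is the set of star bodies (about the origin) in $\mathbb R^n$: compact sets $K$, star-shaped with respect to the origin, whose radial function $\rho(K,u)=\max\{c\ge 0: cu\in K\}$, $u\in S^{n-1}$, is positive and continuous. Two star bodies $K,L$ are dilates if $\rho(K,u)/\rho(L,u)$ is independent of $u\in S^{n-1}$. $S$ denotes spherical Lebesgue measure on $S^{n-1}$. $\mathcal C$ is the class of convex, decreasing functions $\phi:(0,\infty)\to(0,\infty)$ with $\lim_{t\to 0^+}\phi(t)=\infty$ (convention $\phi(0)=\infty$) and $\lim_{t\to\infty}\phi(t)=0$. The dual mixed volume of $K_1,\ldots,K_n\in\mathcal S^n$ is $\widetilde V(K_1,\ldots,K_n)=\frac1n\int_{S^{n-1}}\rho(K_1,u)\cdots\rho(K_n,u)\,dS(u)$. The Orlicz multiple dual mixed volume of $L_1,K_1,\ldots,K_n\in\mathcal S^n$ is $$\widetilde V_\phi(L_1,K_1,\ldots,K_n)=\frac1n\int_{S^{n-1}}\phi\left(\frac{\rho(K_1,u)}{\rho(L_1,u)}\right)\rho(L_1,u)\rho(K_2,u)\cdots\rho(K_n,u)\,dS(u).$$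 *)

(* Defs.v *)
From HB Require Import structures.
From mathcomp Require Import all_boot all_order all_algebra.
From mathcomp Require Import all_classical all_reals all_analysis.
From mathcomp Require Import measurable_realfun.

Set Implicit Arguments.
Unset Strict Implicit.
Unset Printing Implicit Defensive.

Import Order.TTheory GRing.Theory Num.Theory.
Import numFieldNormedType.Exports.

Local Open Scope classical_set_scope.
Local Open Scope ring_scope.

(* The product sigma-algebra on row vectors (same construction as the instance
   on n.-tuple T in measurable_structure.v).  For real entries it is the Borel
   sigma-algebra of R^n. *)

Definition measure_rV_display : measure_display -> measure_display.
Proof. exact. Qed.

Section measurable_rV.
Context {d} {T : sigmaRingType d}.
Variable n : nat.

Let coors : 'I_n -> 'rV[T]_n -> T := fun i x => x ord0 i.

Let rV_set0 : g_sigma_preimage coors set0.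
Proof. exact: sigma_algebra0. Qed.

Let rV_setC A : g_sigma_preimage coors A -> g_sigma_preimage coors (~` A).
Proof. exact: sigma_algebraC. Qed.

Let rV_bigcup (F : _^nat) : (forall i, g_sigma_preimage coors (F i)) ->
  g_sigma_preimage coors (\bigcup_i (F i)).
Proof. exact: sigma_algebra_bigcup. Qed.

HB.instance Definition _ := @isMeasurable.Build (measure_rV_display d)
  'rV[T]_n (g_sigma_preimage coors) rV_set0 rV_setC rV_bigcup.

End measurable_rV.

Section measurable_rV_theory.
Context {R : realType}.

Lemma measurable_rV_coord n (i : 'I_n) :
  measurable_fun [set: 'rV[R]_n] (fun x : 'rV[R]_n => x ord0 i).
Proof.
move=> _ Y mY; rewrite setTI; apply: sub_sigma_algebra => /=.
rewrite -bigcup_seq/=; exists i => /=; first by rewrite mem_index_enum.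
by exists Y => //; rewrite setTI.
Qed.

Lemma measurable_fun_rV d (T : measurableType d) n (f : T -> 'rV[R]_n) :
  (forall i, measurable_fun [set: T] (fun x => f x ord0 i)) ->
  measurable_fun [set: T] f.
Proof.
move=> mf _ A mA; rewrite setTI.
have : preimage_set_system [set: T] f measurable (f @^-1` A).
  by exists A => //; rewrite setTI.
rewrite /measurable/= -g_sigma_preimage_comp.
apply: smallest_sub; first exact: sigma_algebra_measurable.
rewrite -bigcup_seq; apply: bigcup_sub => i _.
by move=> B [C mC <-]; exact: mf.
Qed.

End measurable_rV_theory.

Section lebesgue_rV.
Context {R : realType}.

Definition cons_rV n (p : 'rV[R]_n * measurableTypeR R) : 'rV[R]_n.+1 :=
  \row_i oapp (fun j => p.1 ord0 j) p.2 (unlift ord0 i).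

Lemma measurable_cons_rV n : measurable_fun setT (@cons_rV n).
Proof.
apply: measurable_fun_rV => i; rewrite /cons_rV.
under eq_fun do rewrite mxE.
case: (unlift ord0 i) => [j|] /=; last exact: measurable_snd.
exact: measurableT_comp (measurable_rV_coord j) measurable_fst.
Qed.

Section lebesgue_rVS.
Local Open Scope ereal_scope.
Context n (mu : {measure set 'rV[R]_n -> \bar R}).

Definition lebesgue_rVS : set 'rV[R]_n.+1 -> \bar R :=
  pushforward (mu \x @lebesgue_measure R) (@cons_rV n).

Let mcons := @measurable_cons_rV n.

Let lebesgue_rVS0 : lebesgue_rVS set0 = 0. Proof. exact: measure0. Qed.

Let lebesgue_rVS_ge0 A : 0 <= lebesgue_rVS A. Proof. exact: measure_ge0. Qed.

Let lebesgue_rVS_sigma_additive : semi_sigma_additive lebesgue_rVS.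
Proof. exact: measure_semi_sigma_additive. Qed.

HB.instance Definition _ := isMeasure.Build _ _ _ lebesgue_rVS
  lebesgue_rVS0 lebesgue_rVS_ge0 lebesgue_rVS_sigma_additive.

End lebesgue_rVS.

(* Lebesgue measure on R^n, as the n-fold product of the one on R. *)
Fixpoint lebesgue_rV n : {measure set 'rV[R]_n -> \bar R} :=
  match n with
  | 0 => \d_(0 : 'rV[R]_0)
  | n'.+1 => lebesgue_rVS (lebesgue_rV n')
  end.

End lebesgue_rV.

Section sphere.
Context {R : realType}.

(* `|x| is the sup norm on 'rV[R]_n; it induces the usual topology but not the
   Euclidean unit sphere. *)
Definition euclidean_norm n (x : 'rV[R]_n) : R :=
  Num.sqrt (\sum_i x ord0 i ^+ 2).

Definition sphere n : set 'rV[R]_n := [set u | euclidean_norm u = 1].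

Definition direction n (x : 'rV[R]_n) : 'rV[R]_n :=
  (euclidean_norm x)^-1 *: x.

Definition punctured_ball n : set 'rV[R]_n :=
  [set x | 0 < euclidean_norm x <= 1].

Lemma measurable_euclidean_norm n :
  measurable_fun [set: 'rV[R]_n] (@euclidean_norm n).
Proof.
apply: measurableT_comp; first by apply: continuous_measurable_fun; exact: sqrt_continuous.
apply: measurable_sum => i; apply: measurable_funX.
exact: measurable_rV_coord.
Qed.

Lemma measurable_direction n : measurable_fun [set: 'rV[R]_n] (@direction n).
Proof.
apply: measurable_fun_rV => i; rewrite /direction.
under eq_fun do rewrite mxE.
apply: measurable_funM; last exact: measurable_rV_coord.
under eq_fun do rewrite -powR_inv1 ?sqrtr_ge0//.
exact: (measurableT_comp (measurable_powR _) (@measurable_euclidean_norm n)).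
Qed.

Lemma measurable_punctured_ball n : measurable (@punctured_ball n).
Proof.
rewrite (_ : @punctured_ball n = @euclidean_norm n @^-1` `]0, 1]%classic).
  by rewrite -[X in measurable X]setTI; exact: measurable_euclidean_norm.
by apply/seteqP; split => x /=; rewrite in_itv.
Qed.

Lemma measurable_sphere n : measurable (@sphere n).
Proof.
rewrite (_ : @sphere n = @euclidean_norm n @^-1` [set 1]) //.
by rewrite -[X in measurable X]setTI; exact: measurable_euclidean_norm.
Qed.

End sphere.
Arguments punctured_ball {R} n _.
Arguments sphere {R} n _.

Section sphere_measure.
Local Open Scope ereal_scope.
Context {R : realType} (n : nat).

(* Spherical Lebesgue measure on S^(n-1), viewed as a measure on R^n carried by
   the sphere: n times the volume of the part of the unit ball lying over A.
   For n = 1 this is the counting measure on {-1, 1}. *)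
Definition sphere_measure (A : set 'rV[R]_n) : \bar R :=
  n%:R%:E * lebesgue_rV n (@direction R n @^-1` A `&` punctured_ball n).

Let mdirection := @measurable_direction R n.

Let radial_projection : set 'rV[R]_n -> \bar R :=
  pushforward (mrestr (lebesgue_rV n) (@measurable_punctured_ball R n))
              (@direction R n).

Let radial_projection0 : radial_projection set0 = 0.
Proof. exact: measure0. Qed.

Let radial_projection_ge0 A : 0 <= radial_projection A.
Proof. exact: measure_ge0. Qed.

Let radial_projection_sigma_additive : semi_sigma_additive radial_projection.
Proof. exact: measure_semi_sigma_additive. Qed.

HB.instance Definition _ := isMeasure.Build _ _ _ radial_projection
  radial_projection0 radial_projection_ge0 radial_projection_sigma_additive.

Let sphere_measureE :
  sphere_measure = mscale (NngNum (ler0n R n)) radial_projection.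
Proof. by []. Qed.

Let sphere_measure0 : sphere_measure set0 = 0.
Proof. by rewrite sphere_measureE measure0. Qed.

Let sphere_measure_ge0 A : 0 <= sphere_measure A.
Proof. by rewrite sphere_measureE measure_ge0. Qed.

Let sphere_measure_sigma_additive : semi_sigma_additive sphere_measure.
Proof. by rewrite sphere_measureE; exact: measure_semi_sigma_additive. Qed.

HB.instance Definition _ := isMeasure.Build _ _ _ sphere_measure
  sphere_measure0 sphere_measure_ge0 sphere_measure_sigma_additive.

End sphere_measure.

Section star_bodies.
Context {R : realType}.

Definition star_shaped n (K : set 'rV[R]_n) :=
  forall x (t : R), K x -> 0 <= t <= 1 -> K (t *: x).

(* For compact K and u != 0 the supremum is attained as soon as the ray through
   u meets K; it is 0 by convention when the ray misses K. *)
Definition radial n (K : set 'rV[R]_n) (u : 'rV[R]_n) : R :=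
  sup [set c : R | 0 <= c /\ K (c *: u)].

Definition star_body n (K : set 'rV[R]_n) :=
  [/\ compact K, star_shaped K,
      (forall u, sphere n u -> 0 < radial K u) &
      {within sphere n, continuous (radial K)}].

Definition dilates n (K L : set 'rV[R]_n) :=
  forall u v, sphere n u -> sphere n v ->
    radial K u / radial L u = radial K v / radial L v.

Local Notation S n := (@sphere_measure R n).

Definition dual_mixed_volume n (K : 'I_n -> set 'rV[R]_n) : R :=
  n%:R^-1 * \int[S n]_(u in sphere n) \prod_i radial (K i) u.

(* K_1, ..., K_n are indexed from 0, so that ord0 is the index of K_1.  The
   dimension is n.+1. *)
Definition orlicz_dual_mixed_volume n (phi : R -> R)
    (L1 : set 'rV[R]_n.+1) (K : 'I_n.+1 -> set 'rV[R]_n.+1) : R :=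
  n.+1%:R^-1 * \int[S n.+1]_(u in sphere n.+1)
    (phi (radial (K ord0) u / radial L1 u) * radial L1 u *
     \prod_(i < n.+1 | i != ord0) radial (K i) u).

(* (L1, K_2, ..., K_n) *)
Definition replace_first n (L1 : set 'rV[R]_n.+1)
    (K : 'I_n.+1 -> set 'rV[R]_n.+1) : 'I_n.+1 -> set 'rV[R]_n.+1 :=
  fun j => if j == ord0 then L1 else K j.

(* (K_i, ..., K_i, K_(r+1), ..., K_n), with r copies of K_i *)
Definition repeat_first n (r : nat) (i : 'I_n)
    (K : 'I_n -> set 'rV[R]_n) : 'I_n -> set 'rV[R]_n :=
  fun j => if (j < r)%N then K i else K j.

End star_bodies.

Section orlicz_class.
Context {R : realType}.

(* Only the values of phi on ]0, +oo[ matter.  Convexity, positivity and the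
   limit at +oo make the monotonicity automatically strict. *)
Definition orlicz_class (phi : R -> R) :=
  [/\ (forall t, 0 < t -> 0 < phi t),
      convex_function (E := R^o) `]0, +oo[%classic phi,
      {in `]0, +oo[ &, {homo phi : s t /~ s <= t}},
      phi t @[t --> 0^'+] --> +oo &
      phi t @[t --> +oo] --> 0].

Definition strictly_convex (phi : R -> R) :=
  forall s t a : R, 0 < s -> 0 < t -> s != t -> 0 < a < 1 ->
    phi (a * s + (1 - a) * t) < a * phi s + (1 - a) * phi t.

End orlicz_class.

(* Main.v *)
(* Write w = rho(L_1) rho(K_2) ... rho(K_n) and f = rho(K_1) / rho(L_1), so that the
   integral of f w is that of rho(K_1) ... rho(K_n).  Jensen's inequality for phi,
   f and the weight w bounds V_phi(L_1, K_1, ..., K_n) below by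
   V(L_1, K_2, ..., K_n) phi(V(K_1, ..., K_n) / V(L_1, K_2, ..., K_n)).  Hoelder's
   inequality for rho(K_1), ..., rho(K_r) with weight rho(K_(r+1)) ... rho(K_n)
   bounds V(K_1, ..., K_n) above by the product of the V(K_i, ..., K_i, ...)^(1/r),
   and phi is decreasing.  Both inequalities integrate a pointwise one, and spherical
   measure charges every nonempty relatively open set, so by continuity equality of
   the integrals forces pointwise equality: f is constant and the ratios
   rho(K_i) / rho(K_j), for i, j <= r, are constant. *)

Require Import Defs.
From mathcomp Require Import all_boot all_order all_algebra.
From mathcomp Require Import all_classical all_reals all_analysis.
From mathcomp Require Import measurable_realfun ring lra.

Set Implicit Arguments.
Unset Strict Implicit.
Unset Printing Implicit Defensive.

Import Order.TTheory GRing.Theory Num.Theory.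
Import numFieldNormedType.Exports.

Local Open Scope classical_set_scope.
Local Open Scope ring_scope.

(** * Open sets and boxes in Euclidean space; finiteness and positivity of spherical measure *)

Section Euclidean_topology.
Context {R : realType}.

(** The open sup-norm ball spelled out in coordinates: a finite intersection of coordinate strips,
    whose volume can be computed one coordinate at a time. *)
Definition box n (c : 'rV[R]_n) (e : R) : set 'rV[R]_n :=
  [set y | forall i, `|c ord0 i - y ord0 i| < e].

Lemma measurable_box n (c : 'rV[R]_n) e : measurable (box c e).
Proof.
rewrite (_ : box c e =
    \bigcap_(i in [set: 'I_n]) ((fun y : 'rV[R]_n => y ord0 i) @^-1` ball (c ord0 i) e)).
  apply: fin_bigcap_measurable => // i _; rewrite -[X in measurable X]setTI.
  by apply: measurable_rV_coord => //; exact: measurable_ball.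
by apply/seteqP; split => y yc i; [move=> _; exact: yc|exact: yc].
Qed.

Lemma open_box n (U : set 'rV[R]_n) x : open U -> U x ->
  exists2 e, 0 < e & box x e `<=` U.
Proof.
rewrite openE => oU /oU /nbhs_ballP[e /= e0 eU]; exists e => // y xy.
by apply: eU; split => // i j; rewrite (ord1 i); exact: xy.
Qed.

(** The sigma-algebra is generated by the coordinates, not by the topology. An open set belongs to
    it as the countable union of the boxes with rational centre and radius [k.+1%:R^-1] that it
    contains. *)
Lemma open_measurable_rV n (U : set 'rV[R]_n) : open U -> measurable U.
Proof.
move=> oU.
pose q (p : 'rV[rat]_n * nat) := box (map_mx ratr p.1 : 'rV[R]_n) p.2.+1%:R^-1.
rewrite (_ : U = \bigcup_p (if `[< q p `<=` U >] then q p else set0)).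
  apply: countable_bigcupT_measurable; first exact: countableP.
  by move=> p; case: ifP => _ //; exact: measurable_box.
apply/seteqP; split => [x Ux|x [p _]]; last first.
  by case: ifPn => // /asboolP; exact.
have [e e0 eU] := open_box oU Ux.
(* Two radii must fit within [e]: one from [x] to the rational centre, one from the centre to a
   point of the box. *)
pose k := Num.truncn (2 / e).
have ke : k.+1%:R^-1 + k.+1%:R^-1 < e.
  rewrite -mulr2n -[_ *+ 2]mulr_natl ltr_pdivrMr// mulrC -ltr_pdivrMr//.
  exact: truncnS_gt.
have k0 : 0 < k.+1%:R^-1 :> R by rewrite invr_gt0.
have cq i : {r : rat | `|x ord0 i - ratr r| < k.+1%:R^-1}.
  apply/cid.
  have [|r] := @rat_in_itvoo _ (x ord0 i - k.+1%:R^-1) (x ord0 i + k.+1%:R^-1).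
    by rewrite ltrD2l gtrN.
  by rewrite in_itv/= => xr; exists r; rewrite distrC ltr_distl.
pose p := (\row_i (projT1 (cq i)), k).
have pU : q p `<=` U.
  move=> y py; apply: eU => i; apply: le_lt_trans ke.
  apply: le_trans (ler_distD (ratr (projT1 (cq i))) _ _) _.
  apply: lerD; first by rewrite ltW//; exact: (projT2 (cq i)).
  by have := py i; rewrite /p/= !mxE => /ltW.
exists p => //; case: ifPn => [_ i|/asboolP//].
by rewrite !mxE distrC; exact: (projT2 (cq i)).
Qed.

(** Induction on the dimension: the preimage of a box under [cons_rV] is a box of one dimension less
    times an interval of length [e *+ 2]. In dimension 0 the measure is the Dirac mass at the only
    point. *)
Lemma lebesgue_rV_box n (c : 'rV[R]_n) e : 0 <= e ->
  lebesgue_rV n (box c e) = ((e *+ 2) ^+ n)%:E.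
Proof.
move=> e0; elim: n c => [|n ih] c.
  rewrite /= diracE expr0; congr (_%:E).
  by rewrite mem_set// => -[].
rewrite [LHS]/(((lebesgue_rV n) \x (@lebesgue_measure R)) (@cons_rV R n @^-1` box c e))%E.
rewrite (_ : _ @^-1` _ = box (\row_i c ord0 (lift ord0 i)) e `*` ball (c ord0 ord0) e).
  transitivity (lebesgue_rV n (box (\row_i c ord0 (lift ord0 i)) e) *
      (@lebesgue_measure R) (ball (c ord0 ord0) e))%E.
    by apply: product_measure1E; [exact: measurable_box|exact: measurable_ball].
  by rewrite ih lebesgue_measure_ball// exprSr EFinM.
apply/seteqP; split => [[y t] yt|[y t] [/= yc tc] i].
  split => [i|] /=; last by have := yt ord0; rewrite !mxE unlift_none.
  by have := yt (lift ord0 i); rewrite !mxE liftK.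
rewrite mxE; case: unliftP => [j ->|->]//=.
by have := yc j; rewrite mxE.
Qed.

Lemma euclidean_norm_continuous n : continuous (@euclidean_norm R n).
Proof.
move=> x; apply: (@continuous_comp _ _ _ (fun x : 'rV[R]_n => \sum_i x ord0 i ^+ 2)).
  apply: continuous_big => [|i _ {}x]; first exact: add_continuous.
  apply: (@continuous_comp _ _ _ (fun x : 'rV[R]_n => x ord0 i) (fun t => t ^+ 2)).
    exact: coord_continuous.
  exact: exprn_continuous.
exact: sqrt_continuous.
Qed.

Lemma coord_le_euclidean_norm n (x : 'rV[R]_n) i : `|x ord0 i| <= euclidean_norm x.
Proof.
rewrite -sqrtr_sqr ler_sqrt; last by apply: sumr_ge0 => j _; rewrite sqr_ge0.
by rewrite (bigD1 i)//= lerDl sumr_ge0// => j _; rewrite sqr_ge0.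
Qed.

Lemma euclidean_normZ n a (x : 'rV[R]_n) :
  euclidean_norm (a *: x) = `|a| * euclidean_norm x.
Proof.
rewrite -sqrtr_sqr -sqrtrM ?sqr_ge0// mulr_sumr; congr Num.sqrt.
by apply: eq_bigr => i _; rewrite mxE exprMn.
Qed.

Lemma compact_sphere n : compact (@sphere R n).
Proof.
apply: bounded_closed_compact.
  exists 1; split => // M M1 x Sx; rewrite /= [leLHS]/Num.norm/= mx_normrE.
  apply: bigmax_le => [|[i j] _]/=; first by rewrite (le_trans _ (ltW M1)).
  by rewrite (ord1 i) (le_trans (coord_le_euclidean_norm _ _))// Sx ltW.
rewrite (_ : sphere n = @euclidean_norm R n @^-1` [set 1])//.
apply: preimage_closed; last exact: closed_eq.
by move=> x _; exact: euclidean_norm_continuous.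
Qed.

(** The part of the punctured unit ball lying over the sphere sits inside a box, which has finite
    volume. *)
Lemma sphere_measure_sphere_fin n : (sphere_measure (@sphere R n) < +oo)%E.
Proof.
rewrite /sphere_measure lte_mul_pinfty//.
apply: (@le_lt_trans _ _ (lebesgue_rV n (box (0 : 'rV[R]_n) 2))); last first.
  by rewrite lebesgue_rV_box// ltry.
apply: le_measure; rewrite ?inE.
- apply: measurableI; last exact: measurable_punctured_ball.
  by rewrite -[X in measurable X]setTI; apply: measurable_direction => //; exact: measurable_sphere.
- exact: measurable_box.
- move=> x [_ /andP[_ x1]] i; rewrite mxE sub0r normrN.
  by rewrite (le_lt_trans (coord_le_euclidean_norm _ _))// (le_lt_trans x1)// ltr1n.
Qed.

(** The points of the punctured ball whose direction lies in [U] form a neighbourhood of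
    [2^-1 *: u], hence contain a box of positive volume. The factor one half moves [u] off the
    boundary of the ball. *)
Lemma sphere_measure_open_gt0 n (U : set 'rV[R]_n.+1) u : open U -> U u ->
  sphere n.+1 u -> (0 < sphere_measure (U `&` sphere n.+1))%E.
Proof.
move=> oU Uu Su; rewrite /sphere_measure mule_gt0//.
have u20 : euclidean_norm (2^-1 *: u) = 2^-1.
  by rewrite euclidean_normZ Su mulr1 ger0_norm.
have du : direction (2^-1 *: u) = u.
  by rewrite /direction u20 scalerA invrK divff// scale1r.
have cd : {for 2^-1 *: u, continuous (@direction R n.+1)}.
  have cN : {for 2^-1 *: u, continuous (fun x => (@euclidean_norm R n.+1 x)^-1)}.
    apply: continuousV; last exact: euclidean_norm_continuous.
    by rewrite u20 invr_neq0.
  exact: (continuousZ cN (@cvg_id _ _)).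
have : nbhs (2^-1 *: u) (@direction R n.+1 @^-1` (U `&` sphere n.+1) `&` punctured_ball n.+1).
  have n0 : \forall x \near 2^-1 *: u, 0 < euclidean_norm x.
    by apply: (cvgr_gt _ (@euclidean_norm_continuous n.+1 _)); rewrite u20.
  have n1 : \forall x \near 2^-1 *: u, euclidean_norm x <= 1.
    by apply: (cvgr_le _ (@euclidean_norm_continuous n.+1 _)); rewrite u20 invf_lt1// ltr1n.
  have nU : \forall x \near 2^-1 *: u, U (direction x).
    by apply: cd; rewrite du; exact: open_nbhs_nbhs.
  near=> x; split; last by apply/andP; split; near: x.
  split; first by near: x.
  rewrite /sphere /= euclidean_normZ ger0_norm ?invr_ge0 ?sqrtr_ge0// mulVf// gt_eqF//.
  by near: x.
move=> /nbhs_ballP[e /= e0 eU].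
apply: (@lt_le_trans _ _ (lebesgue_rV n.+1 (box (2^-1 *: u) e))).
  by rewrite lebesgue_rV_box ?ltW// lte_fin exprn_gt0// mulrn_wgt0.
apply: le_measure; rewrite ?inE.
- exact: measurable_box.
- apply: measurableI; last exact: measurable_punctured_ball.
  rewrite -[X in measurable X]setTI; apply: measurable_direction => //.
  by apply: measurableI; [exact: open_measurable_rV|exact: measurable_sphere].
- move=> y uy; apply: eU; split => // i j; rewrite (ord1 i); exact: uy.
Unshelve. all: by end_near. Qed.

Lemma within_continuous_measurable_rV n (D : set 'rV[R]_n) (f : 'rV[R]_n -> R) :
  measurable D -> {within D, continuous f} -> measurable_fun D f.
Proof.
move=> mD /continuousP cf; apply: (measurability _ (RGenOpens.measurableE R)).
move=> _ [_ [a [b ->] <-]].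
have /open_subspaceP[V oV VD] : open (f @^-1` `]a, b[%classic : set (subspace D)).
  exact/cf/interval_open.
by rewrite setIC -VD; apply: measurableI => //; exact: open_measurable_rV.
Qed.

End Euclidean_topology.

(** * Algebra of functions continuous on a subset *)

Section within_continuity.
Context {R : realType} {T : topologicalType} (A : set T).
Implicit Types f g : T -> R.

Lemma within_continuousM f g : {within A, continuous f} ->
  {within A, continuous g} -> {within A, continuous (fun x => f x * g x)}.
Proof. by move=> cf cg x; apply: cvgM; [exact: cf|exact: cg]. Qed.

Lemma within_continuousV f : {within A, continuous f} ->
  (forall x, A x -> f x != 0) -> {within A, continuous (fun x => (f x)^-1)}.
Proof.
move=> cf f0; rewrite continuous_subspace_in => x /set_mem Ax.
by apply: cvgV; [exact: f0|exact: cf].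
Qed.

Lemma within_continuous_prod (I : Type) (s : seq I) (P : pred I) (f : I -> T -> R) :
  (forall i, {within A, continuous (f i)}) ->
  {within A, continuous (fun x => \prod_(i <- s | P i) f i x)}.
Proof.
move=> cf; apply: (@continuous_big R^o) => [|i _]; last exact: cf.
exact: mul_continuous.
Qed.

Lemma within_continuous_sum (I : Type) (s : seq I) (P : pred I) (f : I -> T -> R) :
  (forall i, {within A, continuous (f i)}) ->
  {within A, continuous (fun x => \sum_(i <- s | P i) f i x)}.
Proof.
move=> cf; apply: (@continuous_big R^o) => [|i _]; last exact: cf.
exact: add_continuous.
Qed.

Lemma within_continuousX f k : {within A, continuous f} ->
  {within A, continuous (fun x => f x ^+ k)}.
Proof.
move=> cf; elim: k => [|k ih]; first by under eq_fun do rewrite expr0; exact: cst_continuous.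
by under eq_fun do rewrite exprS; exact: within_continuousM.
Qed.

End within_continuity.

(** * Chords and support lines of convex functions on the positive reals *)

Section convex_on_positive_reals.
Context {R : realType} (phi : R -> R).

Lemma convex_function_le : convex_function (E := R^o) `]0, +oo[%classic phi ->
  forall s t a, 0 < s -> 0 < t -> 0 <= a <= 1 ->
    phi (a * s + (1 - a) * t) <= a * phi s + (1 - a) * phi t.
Proof.
move=> cphi s t a s0 t0 /andP[a0 a1].
have := cphi (Itv01 a0 a1) s t; rewrite !inE/= !in_itv/= !andbT => /(_ s0 t0).
by [].
Qed.

Hypothesis cphi : convex_function (E := R^o) `]0, +oo[%classic phi.

(** [m] is the convex combination of [s] and [t] that gives [s] the weight [(t - m) / (t - s)];
    convexity there, cleared of denominators, compares the slopes. *)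
Lemma convex_three_slopes s m t : 0 < s -> s < m -> m < t ->
  (phi s - phi m) / (s - m) <= (phi t - phi m) / (t - m).
Proof.
move=> s0 sm mt.
have ts : 0 < t - s by rewrite subr_gt0 (lt_trans sm).
have := convex_function_le cphi (a := (t - m) / (t - s)) s0 (lt_trans s0 (lt_trans sm mt)).
have -> : (t - m) / (t - s) * s + (1 - (t - m) / (t - s)) * t = m.
  by field; rewrite gt_eqF.
have -> : 0 <= (t - m) / (t - s) <= 1.
  by apply/andP; split; rewrite ?divr_ge0 ?ler_pdivrMr//; lra.
move=> /(_ isT).
have -> : (t - m) / (t - s) * phi s + (1 - (t - m) / (t - s)) * phi t =
   ((t - m) * phi s + (m - s) * phi t) / (t - s).
  by field; rewrite gt_eqF.
rewrite ler_pdivlMr// => h.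
rewrite -[s - m]opprB invrN mulrN -mulNr opprB ler_pdivrMr ?subr_gt0//.
by rewrite mulrAC ler_pdivlMr ?subr_gt0//; nra.
Qed.

(** The slope [c] is the supremum of the slopes of chords from the left of [m]. Every chord slope to
    the right is an upper bound of these, so the line stays below [phi] on both sides. *)
Lemma convex_support_line m : 0 < m ->
  exists c, forall t, 0 < t -> phi m + c * (t - m) <= phi t.
Proof.
move=> m0.
pose E := [set (phi s - phi m) / (s - m) | s in [set s | 0 < s < m]].
have E0 : E !=set0.
  by exists ((phi (m / 2) - phi m) / (m / 2 - m)); exists (m / 2) => //=; lra.
have ubE t : m < t -> ubound E ((phi t - phi m) / (t - m)).
  by move=> mt _ [s /= /andP[s0 sm] <-]; exact: convex_three_slopes.
have hE : has_ubound E by exists ((phi (m + 1) - phi m) / (m + 1 - m)); apply: ubE; lra.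
exists (sup E) => t t0; have [tm|mt|->] := ltgtP t m; last by rewrite subrr mulr0 addr0.
  have : (phi t - phi m) / (t - m) <= sup E by apply: ub_le_sup => //; exists t => //=; rewrite t0.
  by rewrite -[t - m]opprB invrN mulrN -mulNr opprB ler_pdivrMr ?subr_gt0//; lra.
have : sup E <= (phi t - phi m) / (t - m) by apply: ge_sup => //; exact: ubE.
by rewrite ler_pdivlMr ?subr_gt0//; lra.
Qed.

Hypothesis sphi : strictly_convex phi.

(** A second contact point would put the value of [phi] at the midpoint strictly below the line. *)
Lemma strictly_convex_support_line m c : 0 < m ->
  (forall t, 0 < t -> phi m + c * (t - m) <= phi t) ->
  forall t, 0 < t -> phi t = phi m + c * (t - m) -> t = m.
Proof.
move=> m0 sup t t0 tE; apply/eqP/negP => /negP tm.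
have := sphi t0 m0 tm (a := 2^-1).
have -> : 0 < (2^-1 : R) < 1 by lra.
move=> /(_ isT).
have : 0 < 2^-1 * t + (1 - 2^-1) * m by lra.
by move=> /sup; rewrite tE; lra.
Qed.

(** The value at the midpoint is at least [phi t] by monotonicity and less than the average of
    [phi s] and [phi t] by strict convexity. *)
Lemma strictly_convex_decreasing : {in `]0, +oo[ &, {homo phi : s t /~ s <= t}} ->
  forall s t, 0 < s -> s < t -> phi t < phi s.
Proof.
move=> dphi s t s0 st; have t0 := lt_trans s0 st.
have pos x : 0 < x -> x \in `]0, +oo[ by rewrite in_itv/= andbT.
have h1 : phi t <= phi s by apply: dphi; rewrite ?pos ?ltW.
have := sphi s0 t0 (negbT (lt_eqF st)) (a := 2^-1).
have -> : 0 < (2^-1 : R) < 1 by lra.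
move=> /(_ isT).
have : phi t <= phi (2^-1 * s + (1 - 2^-1) * t).
  by apply: dphi; rewrite ?pos//; lra.
lra.
Qed.

End convex_on_positive_reals.

(** Superlevel sets of a monotone function are intervals. *)
Lemma nonincreasing_measurable_fun_pos {R : realType} (phi : R -> R) :
  {in `]0, +oo[ &, {homo phi : s t /~ s <= t}} -> 
  measurable_fun (`]0, +oo[%classic : set R) phi.
Proof.
move=> dphi; apply: (measurability _ (RGenOInfty.measurableE R)) => _ [_ [a ->] <-].
apply: is_interval_measurable => x y [/= x0 _] [y0 ay] z /andP[xz zy].
move: x0 y0 ay; rewrite /= !in_itv/= !andbT => x0 y0 ay.
have z0 := lt_le_trans x0 xz; split => //.
by rewrite (lt_le_trans ay)// dphi// in_itv/= andbT.
Qed.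

(** * Integration of bounded and continuous functions over the sphere *)

Section sphere_integral.
Context {R : realType} {n : nat}.
Local Notation S := (@sphere R n.+1).
Local Notation sigma := (@sphere_measure R n.+1).
Implicit Types f g w : 'rV[R]_n.+1 -> R.

Lemma sphere_nonempty : S !=set0.
Proof.
exists (delta_mx ord0 ord0); rewrite /sphere/= /euclidean_norm (bigD1 ord0)//=.
rewrite big1 ?mxE ?eqxx ?expr1n ?addr0 ?sqrtr1// => i /negPf i0.
by rewrite mxE i0 andbF expr0n.
Qed.

Lemma bounded_sphere_integrable f M : measurable_fun S f ->
  (forall u, S u -> `|f u| <= M) -> sigma.-integrable S (EFin \o f).
Proof.
move=> mf fM; apply: measurable_bounded_integrable => //.
- exact: measurable_sphere.
- exact: sphere_measure_sphere_fin.
- by exists M; split; [exact: num_real|move=> N MN u Su; exact: le_trans (fM _ Su) (ltW MN)].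
Qed.

Lemma within_continuous_sphere_bounded f : {within S, continuous f} ->
  exists M, forall u, S u -> `|f u| <= M.
Proof.
move=> cf; have [M [_ fM]] := compact_bounded (continuous_compact cf (@compact_sphere R _)).
by exists (M + 1) => u Su; apply: (fM (M + 1)); [rewrite ltrDl|exists u].
Qed.

Lemma within_continuous_sphere_integrable f : {within S, continuous f} ->
  sigma.-integrable S (EFin \o f).
Proof.
move=> cf; have [M fM] := within_continuous_sphere_bounded cf.
apply: bounded_sphere_integrable fM.
by apply: within_continuous_measurable_rV => //; exact: measurable_sphere.
Qed.

(* Nonempty relatively open subsets of the sphere have positive measure, so a
   continuous function vanishing almost everywhere vanishes everywhere. *)
Lemma sphere_integral_eq0 g f : sigma.-integrable S (EFin \o g) ->
  (forall u, S u -> 0 <= g u) -> \int[sigma]_(u in S) g u = 0 ->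
  {within S, continuous f} -> (forall u, S u -> g u = 0 -> f u = 0) ->
  forall u, S u -> f u = 0.
Proof.
move=> ig g0 Ig cf gf u Su; apply/eqP/negP => /negP fu0.
have mS := @measurable_sphere R n.+1.
have : (\int[sigma]_(u in S) `|(EFin \o g) u| = 0)%E.
  rewrite (eq_integral (EFin \o g)); last first.
    by move=> v /set_mem Sv; rewrite /= ger0_norm ?g0.
  rewrite -[LHS]fineK; last exact: integrable_fin_num.
  by congr (_%:E).
move/(ae_eq_integral_abs _ mS (measurable_int _ ig)) => aeg.
(* Only [f] is continuous; [g] may be merely integrable. The set where [f] is nonzero is the trace
   of an open [V] on the sphere, and [g] is nonzero there, so that trace is negligible. *)
have /continuousP/(_ _ (@open_neq R 0)) := cf.
move/open_subspaceP => [V oV VS].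
have VE v : S v -> V v <-> f v != 0.
  move=> Sv; split=> [Vv|fv0].
    by have : (V `&` S) v by []; rewrite VS => -[].
  by have : (f @^-1` [set x | x != 0] `&` S) v by []; rewrite -VS => -[].
have := sphere_measure_open_gt0 oV ((VE _ Su).2 fu0) Su.
rewrite measure_negligible ?ltxx//.
  by apply: measurableI => //; exact: open_measurable_rV.
apply: negligibleS aeg => v [Vv Sv] /= /(_ Sv) [gv0].
by move: (VE v Sv).1 => /(_ Vv); rewrite gf ?eqxx.
Qed.

(** A zero integral would make the continuous function [f] vanish on the whole sphere, which is
    nonempty. *)
Lemma sphere_integral_gt0 f : {within S, continuous f} ->
  (forall u, S u -> 0 < f u) -> 0 < \int[sigma]_(u in S) f u.
Proof.
move=> cf f0; rewrite lt_neqAle Rintegral_ge0 ?andbT; last by move=> u /f0/ltW.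
apply/eqP => /esym If0; have [u Su] := sphere_nonempty.
suff : f u = 0 by move=> fu; have := f0 _ Su; rewrite fu ltxx.
apply: (sphere_integral_eq0 _ _ If0) => //; last by move=> v /f0/ltW.
exact: within_continuous_sphere_integrable.
Qed.

Lemma sphere_integral_sum (I : Type) (s : seq I) (P : pred I)
    (F : I -> 'rV[R]_n.+1 -> R) :
  (forall i, {within S, continuous (F i)}) ->
  \int[sigma]_(u in S) (\sum_(i <- s | P i) F i u) =
  \sum_(i <- s | P i) \int[sigma]_(u in S) F i u.
Proof.
move=> cF; elim: s => [|i s ih].
  rewrite big_nil (eq_Rintegral _ (g := cst 0)); last by move=> u _; rewrite big_nil.
  by rewrite Rintegral_cst ?mul0r//; exact: measurable_sphere.
rewrite big_cons; under eq_Rintegral do rewrite big_cons.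
case: ifP => _ //; rewrite RintegralD ?ih//; first exact: measurable_sphere.
- exact: within_continuous_sphere_integrable.
- by apply: within_continuous_sphere_integrable; exact: within_continuous_sum.
Qed.

End sphere_integral.

(** * Jensen and Hoelder inequalities on the sphere, with their equality cases *)

Section sphere_inequalities.
Context {R : realType} {n : nat}.
Local Notation S := (@sphere R n.+1).
Local Notation sigma := (@sphere_measure R n.+1).
Implicit Types f g h w : 'rV[R]_n.+1 -> R.

(** [phi] blows up at 0, but by compactness [f] has a positive minimum on the sphere, and the value
    of [phi] at that minimum bounds [phi (f u)]. Measurability comes from monotonicity. *)
Lemma orlicz_sphere_integrable (phi : R -> R) f w : orlicz_class phi ->
  {within S, continuous f} -> (forall u, S u -> 0 < f u) ->
  {within S, continuous w} ->
  sigma.-integrable S (EFin \o (fun u => phi (f u) * w u)).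
Proof.
move=> [phi0 _ dphi _ _] cf f0 cw.
have [v /set_mem Sv fv] := compact_EVT_min sphere_nonempty (@compact_sphere R _) cf.
have [M wM] := within_continuous_sphere_bounded cw.
have mS := @measurable_sphere R n.+1.
apply: (@bounded_sphere_integrable _ _ _ (phi (f v) * M)).
  apply: measurable_funM; last exact: within_continuous_measurable_rV.
  apply: (measurable_comp (measurable_itv `]0, +oo[)).
  - by move=> _ [u Su <-]; rewrite /= in_itv/= andbT f0.
  - exact: nonincreasing_measurable_fun_pos.
  - exact: within_continuous_measurable_rV.
move=> u Su; rewrite normrM ler_pM// ?wM//.
rewrite gtr0_norm; last exact/phi0/f0.
apply: dphi; rewrite ?in_itv/= ?andbT ?f0//.
by apply: fv; exact: mem_set.
Qed.

(* Integrate the inequality between [phi] and its support line at the mean. *)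
Lemma sphere_jensen (phi : R -> R) f w : orlicz_class phi ->
  {within S, continuous f} -> (forall u, S u -> 0 < f u) ->
  {within S, continuous w} -> (forall u, S u -> 0 < w u) ->
  let m := \int[sigma]_(u in S) (f u * w u) / \int[sigma]_(u in S) w u in
  let lhs := \int[sigma]_(u in S) (phi (f u) * w u) in
  let rhs := \int[sigma]_(u in S) w u * phi m in
  rhs <= lhs /\ (strictly_convex phi -> lhs = rhs -> forall u, S u -> f u = m).
Proof.
move=> ophi cf f0 cw w0 m lhs rhs; have mS := @measurable_sphere R n.+1.
have Iw0 := sphere_integral_gt0 cw w0.
have cfw := within_continuousM cf cw.
have m0 : 0 < m.
  by rewrite divr_gt0//; apply: sphere_integral_gt0 => // u Su; rewrite mulr_gt0 ?f0 ?w0.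
have [_ cphi _ _ _] := ophi.
have [c supp] := convex_support_line cphi m0.
(* [G] is [w] times the gap between [phi] and its support line at [f u], with the line expanded into
   multiples of [w] and [f * w] that can be integrated separately. *)
pose G u := phi (f u) * w u - ((phi m - c * m) * w u + c * (f u * w u)).
have iphi := orlicz_sphere_integrable ophi cf f0 cw.
have iw := within_continuous_sphere_integrable cw.
have ifw := within_continuous_sphere_integrable cfw.
have i1 : sigma.-integrable S (EFin \o (fun u => (phi m - c * m) * w u)).
  exact/within_continuous_sphere_integrable/within_continuousM/cw/cst_continuous.
have i2 : sigma.-integrable S (EFin \o (fun u => c * (f u * w u))).
  exact/within_continuous_sphere_integrable/within_continuousM/cfw/cst_continuous.
have i12 : sigma.-integrable S (EFin \o (fun u => (phi m - c * m) * w u + c * (f u * w u))).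
  by exact: (integrableD mS i1 i2).
have iG : sigma.-integrable S (EFin \o G) by exact: (integrableB mS iphi i12).
have G0 u : S u -> 0 <= G u.
  move=> Su; have := supp _ (f0 _ Su); have := w0 _ Su; rewrite /G => wu h.
  have -> : phi (f u) * w u - ((phi m - c * m) * w u + c * (f u * w u)) =
    (phi (f u) - (phi m + c * (f u - m))) * w u by ring.
  by rewrite mulr_ge0 ?subr_ge0// ltW.
have IG : \int[sigma]_(u in S) G u = lhs - rhs.
  rewrite RintegralB// RintegralD// !RintegralZl//; congr (_ - _).
  rewrite /rhs.
  (* Since [m] is the mean of [f] with weight [w], the terms in [c] cancel. *)
  have -> : \int[sigma]_(u in S) (f u * w u) = m * \int[sigma]_(u in S) w u.
    by rewrite /m divfK// gt_eqF.
  ring.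
split=> [|sphi E u Su]; first by rewrite -subr_ge0 -IG Rintegral_ge0.
apply/eqP; rewrite -subr_eq0; apply/eqP.
apply: (sphere_integral_eq0 (f := fun u => f u - m) iG G0 _ _ _ Su).
- by rewrite IG E subrr.
- by apply: within_continuousB => //; exact: cst_continuous.
- move=> v Sv Gv; apply/eqP; rewrite subr_eq0; apply/eqP.
  apply: (strictly_convex_support_line sphi m0 supp); first exact: f0.
  (* Multiplication by the nonzero [w v] turns the gap into [G v]. *)
  apply/eqP; rewrite -subr_eq0 -(mulIr_eq0 _ (mulIf (lt0r_neq0 (w0 _ Sv)))).
  by rewrite -[X in _ == X]Gv /G; apply/eqP; ring.
Qed.

(** AM-GM for the powers [x i ^+ #|P|], whose product is the [#|P|]-th power of the product of the
    [x i]. Positivity allows taking roots, both in the bound and in the equality case. *)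
Lemma ler_prod_mean (I : finType) (P : {pred I}) (x : I -> R) :
  (0 < #|P|)%N -> (forall i, i \in P -> 0 < x i) ->
  let mean := (\sum_(i in P) x i ^+ #|P|) / #|P|%:R in
  \prod_(i in P) x i <= mean /\
  (\prod_(i in P) x i = mean -> {in P &, forall i j, x i = x j}).
Proof.
move=> P0 x0 mean.
have /(@leif_AGM _ _ P) : {in P, forall i, 0 <= x i ^+ #|P|}.
  by move=> i iP; rewrite exprn_ge0// ltW ?x0.
rewrite prodrXl -/mean => -[le_mean eq_mean].
have p0 : 0 <= \prod_(i in P) x i by apply: prodr_ge0 => i /x0/ltW.
have mean0 : 0 <= mean.
  by rewrite divr_ge0//; apply: sumr_ge0 => i /x0/ltW xi; rewrite exprn_ge0.
split; first by move: le_mean; rewrite ler_pXn2r.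
move=> E; move: eq_mean; rewrite E eqxx => /esym/forallP h i j iP jP.
have := h i; rewrite iP => /forallP/(_ j); rewrite jP /= => /eqP/eqP.
by rewrite eqrXn2 ?ltW ?x0// => /eqP.
Qed.

(* AM-GM applied to the normalized functions [f i / a i]. *)
Lemma sphere_holder (I : finType) (P : {pred I}) (f : I -> 'rV[R]_n.+1 -> R) g :
  (0 < #|P|)%N -> (forall i, {within S, continuous (f i)}) ->
  (forall i u, S u -> 0 < f i u) ->
  {within S, continuous g} -> (forall u, S u -> 0 < g u) ->
  let A i := \int[sigma]_(u in S) (f i u ^+ #|P| * g u) in
  let lhs := \int[sigma]_(u in S) (\prod_(i in P) f i u * g u) in
  let rhs := \prod_(i in P) A i `^ #|P|%:R^-1 in
  lhs <= rhs /\ (lhs = rhs -> forall i j, i \in P -> j \in P ->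
     forall u v, S u -> S v -> f i u / f j u = f i v / f j v).
Proof.
move=> P0 cf f0 cg g0 A lhs rhs; have mS := @measurable_sphere R n.+1.
have N0 : (#|P|%:R : R) != 0 by rewrite pnatr_eq0 -lt0n.
have cA i : {within S, continuous (fun u => f i u ^+ #|P| * g u)}.
  by apply: within_continuousM => //; exact: within_continuousX.
have A0 i : 0 < A i.
  by apply: sphere_integral_gt0 => // u Su; rewrite mulr_gt0 ?g0// exprn_gt0 ?f0.
(* Norming factors: the [#|P|]-th power of [f i / a i] has integral 1 against [g], and the product
   of the [a i] over [P] is [rhs]. *)
pose a i := A i `^ #|P|%:R^-1.
have a0 i : 0 < a i by rewrite powR_gt0.
have aA i : a i ^+ #|P| = A i.
  by rewrite -powR_mulrn ?powR_ge0// -powRrM mulVf// powRr1 ?ltW.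
have rhs0 : 0 < rhs by apply: prodr_gt0 => i _; exact: a0.
(* As [E1] and [E2] show, these are the two sides of AM-GM for the [f i / a i], each times [g].
   Their integrals are 1 and [lhs / rhs]. *)
pose G1 u := \sum_(i in P) (A i)^-1 / #|P|%:R * (f i u ^+ #|P| * g u).
pose G2 u := rhs^-1 * (\prod_(i in P) f i u * g u).
have cP : {within S, continuous (fun u => \prod_(i in P) f i u * g u)}.
  by apply: within_continuousM => //; exact: within_continuous_prod.
have c1i i : {within S, continuous (fun u => (A i)^-1 / #|P|%:R * (f i u ^+ #|P| * g u))}.
  by apply: within_continuousM => //; exact: cst_continuous.
have c1 : {within S, continuous G1} by exact: within_continuous_sum.
have c2 : {within S, continuous G2}.
  by apply: within_continuousM => //; exact: cst_continuous.
have E1 u : G1 u = (\sum_(i in P) (f i u / a i) ^+ #|P|) / #|P|%:R * g u.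
  rewrite /G1 mulrAC !mulr_suml; apply: eq_bigr => i _.
  rewrite expr_div_n aA; field.
  by rewrite N0 gt_eqF.
have E2 u : G2 u = \prod_(i in P) (f i u / a i) * g u.
  rewrite /G2 prodf_div mulrA; congr (_ * _).
  by rewrite mulrC.
have fa0 u : S u -> forall i, i \in P -> 0 < f i u / a i.
  by move=> Su i _; rewrite divr_gt0 ?f0.
have G0 u : S u -> 0 <= G1 u - G2 u.
  move=> Su; rewrite E1 E2 -mulrBl mulr_ge0 ?subr_ge0//; last by rewrite ltW ?g0.
  exact: (ler_prod_mean P0 (fa0 u Su)).1.
have IG : \int[sigma]_(u in S) (G1 u - G2 u) = 1 - lhs / rhs.
  rewrite RintegralB//; [|exact: within_continuous_sphere_integrable..].
  rewrite sphere_integral_sum// RintegralZl//; last exact: within_continuous_sphere_integrable.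
  congr (_ - _); last by rewrite mulrC.
  rewrite (eq_bigr (fun=> #|P|%:R^-1)) => [|i _].
    by rewrite sumr_const -[LHS]mulr_natl mulfV.
  rewrite RintegralZl//; last exact: within_continuous_sphere_integrable.
  by rewrite -/(A i) mulrAC mulVf ?mul1r// gt_eqF.
split=> [|E i j iP jP u v Su Sv].
  have : 0 <= 1 - lhs / rhs by rewrite -IG; exact: Rintegral_ge0.
  by rewrite subr_ge0 ler_pdivrMr// mul1r.
have cG : {within S, continuous (fun u => G1 u - G2 u)} by exact: within_continuousB.
have G0E : forall u, S u -> G1 u - G2 u = 0.
  apply: (sphere_integral_eq0 _ G0) => //.
    exact: within_continuous_sphere_integrable.
  by rewrite IG E divff ?subrr// gt_eqF.
(* Equality in AM-GM makes the [f i / a i] agree over [P], so each ratio is the constant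
   [a i / a j]. *)
have fij z : S z -> f i z / f j z = a i / a j.
  move=> Sz; have /eqP := G0E _ Sz; rewrite subr_eq0 E1 E2 => /eqP/mulIf h.
  have /(_ _ _ iP jP) := (ler_prod_mean P0 (fa0 z Sz)).2 (esym (h (lt0r_neq0 (g0 _ Sz)))).
  move=> /eqP; rewrite eqr_div ?lt0r_neq0 ?a0// => /eqP h'.
  by apply/eqP; rewrite eqr_div ?lt0r_neq0 ?f0// h' mulrC.
by rewrite !fij.
Qed.

(** The converse equality case of Hoelder: both sides equal the product of the [c i] times the
    integral of [h ^+ #|P| * g]. *)
Lemma sphere_holder_proportional (I : finType) (P : {pred I})
    (f : I -> 'rV[R]_n.+1 -> R) h g (c : I -> R) :
  (0 < #|P|)%N -> {within S, continuous h} ->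
  (forall u, S u -> 0 < h u) ->
  {within S, continuous g} -> (forall u, S u -> 0 < g u) ->
  (forall i, i \in P -> 0 < c i) ->
  (forall i u, i \in P -> S u -> f i u = c i * h u) ->
  \int[sigma]_(u in S) (\prod_(i in P) f i u * g u) =
  \prod_(i in P) (\int[sigma]_(u in S) (f i u ^+ #|P| * g u)) `^ #|P|%:R^-1.
Proof.
move=> P0 ch h0 cg g0 c0 fE; have mS := @measurable_sphere R n.+1.
have chg : {within S, continuous (fun u => h u ^+ #|P| * g u)}.
  by apply: within_continuousM => //; exact: within_continuousX.
have ihg := within_continuous_sphere_integrable chg.
pose B := \int[sigma]_(u in S) (h u ^+ #|P| * g u).
have B0 : 0 < B.
  by apply: sphere_integral_gt0 => // u Su; rewrite mulr_gt0 ?g0// exprn_gt0 ?h0.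
have N0 : (#|P|%:R : R) != 0 by rewrite pnatr_eq0 -lt0n.
transitivity (\prod_(i in P) (c i * B `^ #|P|%:R^-1)).
  rewrite big_split/= prodr_const -powR_mulrn ?powR_ge0// -powRrM mulVf//.
  rewrite powRr1 ?ltW// -RintegralZl//; apply: eq_Rintegral => u /set_mem Su.
  rewrite mulrA; congr (_ * _); rewrite -prodr_const -big_split/=.
  by apply: eq_bigr => i iP; exact: fE.
apply: eq_bigr => i iP.
have -> : \int[sigma]_(u in S) (f i u ^+ #|P| * g u) = c i ^+ #|P| * B.
  rewrite -RintegralZl//; apply: eq_Rintegral => u /set_mem Su.
  by rewrite fE// exprMn mulrA.
rewrite powRM ?exprn_ge0 ?ltW ?c0//; congr (_ * _).
by rewrite -powR_mulrn ?ltW ?c0// -powRrM mulfV// powRr1 ?ltW ?c0.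
Qed.

End sphere_inequalities.

(* The dimension is n.+1 >= 1, and K i stands for K_(i+1). *)
Theorem theorem5p2 (R : realType) (n r : nat)
    (L1 : set 'rV[R]_n.+1) (K : 'I_n.+1 -> set 'rV[R]_n.+1) (phi : R -> R)
    (hL1 : star_body L1) (hK : forall i, star_body (K i))
    (hr : (1 <= r <= n.+1)%N) (hphi : orlicz_class phi) :
  let lhs := orlicz_dual_mixed_volume phi L1 K in
  let V1 := dual_mixed_volume (replace_first L1 K) in
  let rhs := V1 * phi
    ((\prod_(i < n.+1 | (i < r)%N)
        dual_mixed_volume (repeat_first r i K) `^ (r%:R^-1)) / V1) in
  lhs >= rhs /\
  (strictly_convex phi ->
    (lhs = rhs <->
     (forall i : 'I_n.+1, (i < r)%N -> dilates L1 (K i)) /\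
     (forall i j : 'I_n.+1, (i < r)%N -> (j < r)%N -> dilates (K i) (K j)))).
Proof.
move=> lhs V1 rhs; move/andP: hr => [r0 rn].
have [_ _ L0 cL] := hL1.
have K0 i u : sphere n.+1 u -> 0 < radial (K i) u by have [_ _ + _] := hK i; exact.
have cK i : {within sphere n.+1, continuous (radial (K i))} by have [_ _ _ +] := hK i.
(* The indices of the first [r] bodies; [#|P|] is then the Hoelder exponent. *)
pose P : pred 'I_n.+1 := fun i => (i < r)%N.
have PE i : (i \in P) = (i < r)%N by [].
have cardP : #|P| = r.
  rewrite -sum1_card (eq_bigl (fun i : 'I_n.+1 => (i < r)%N))//.
  by rewrite (big_ord_narrow rn) /= sum1_card card_ord.
have P0 : (0 < #|P|)%N by rewrite cardP.
pose N : R := n.+1%:R^-1.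
have N0 : 0 < N by rewrite invr_gt0.
pose rest u := \prod_(i < n.+1 | i != ord0) radial (K i) u.
pose f u := radial (K ord0) u / radial L1 u.
pose w u := radial L1 u * rest u.
pose g u := \prod_(i < n.+1 | i \notin P) radial (K i) u.
have crest : {within sphere n.+1, continuous rest} by exact: within_continuous_prod.
have cw : {within sphere n.+1, continuous w} by exact: within_continuousM.
have cg : {within sphere n.+1, continuous g} by exact: within_continuous_prod.
have cf : {within sphere n.+1, continuous f}.
  apply: within_continuousM => //; apply: within_continuousV => // u Su.
  by rewrite gt_eqF ?L0.
have g0 u : sphere n.+1 u -> 0 < g u by move=> Su; apply: prodr_gt0 => i _; exact: K0.
have w0 u : sphere n.+1 u -> 0 < w u.
  by move=> Su; rewrite mulr_gt0 ?L0//; apply: prodr_gt0 => i _; exact: K0.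
have f0 u : sphere n.+1 u -> 0 < f u by move=> Su; rewrite divr_gt0 ?K0 ?L0.
pose J := \int[@sphere_measure R n.+1]_(u in sphere n.+1) w u.
pose X := \int[@sphere_measure R n.+1]_(u in sphere n.+1) (f u * w u).
pose A i := \int[@sphere_measure R n.+1]_(u in sphere n.+1) (radial (K i) u ^+ #|P| * g u).
pose H := \prod_(i in P) A i `^ #|P|%:R^-1.
have J0 : 0 < J by exact: sphere_integral_gt0.
have X0 : 0 < X.
  apply: sphere_integral_gt0; first exact: within_continuousM.
  by move=> u Su; rewrite mulr_gt0 ?f0 ?w0.
have V1E : V1 = N * J.
  congr (_ * _); apply: eq_Rintegral => u _; rewrite (bigD1 ord0)//=.
  rewrite /replace_first eqxx; congr (_ * _).
  by apply: eq_bigr => i /negPf ->.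
have lhsE : lhs = N * \int[@sphere_measure R n.+1]_(u in sphere n.+1) (phi (f u) * w u).
  by congr (_ * _); apply: eq_Rintegral => u _; rewrite mulrA.
have XE : X = \int[@sphere_measure R n.+1]_(u in sphere n.+1)
    (\prod_(i in P) radial (K i) u * g u).
  apply: eq_Rintegral => u /set_mem Su.
  (* The factor [radial L1] cancels in [f * w], leaving the product over all indices, which is split
     along [P]. *)
  rewrite mulrA divfK ?gt_eqF ?L0// -[RHS](bigID (mem P) xpredT).
  by rewrite [RHS](bigD1 ord0).
have VE i : dual_mixed_volume (repeat_first r i K) = N * A i.
  congr (_ * _); apply: eq_Rintegral => u _.
  rewrite (bigID (mem P))/= -prodr_const; congr (_ * _).
    by apply: eq_bigr => j; rewrite /repeat_first PE => ->.
  by apply: eq_bigr => j; rewrite /repeat_first PE => /negPf ->.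
have prodE : \prod_(i < n.+1 | (i < r)%N)
    dual_mixed_volume (repeat_first r i K) `^ r%:R^-1 = N * H.
  (* The normalising factor enters [r] times to the power [1/r], so exactly one [N] survives; it
     later cancels in the argument of [phi]. *)
  transitivity (\prod_(i in P) (N `^ #|P|%:R^-1 * A i `^ #|P|%:R^-1)).
    rewrite cardP; apply: eq_bigr => i _.
    rewrite VE powRM//; first exact: ltW.
    by apply: Rintegral_ge0 => u Su; rewrite mulr_ge0 ?exprn_ge0// ltW ?K0 ?g0.
  rewrite big_split/= prodr_const; congr (_ * _).
  rewrite -powR_mulrn ?powR_ge0// -powRrM mulVf ?powRr1 ?ltW//.
  by rewrite pnatr_eq0 -lt0n.
have rhsE : rhs = N * (J * phi (H / J)).
  rewrite /rhs prodE V1E -mulrA; congr (_ * (_ * phi _)).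
  by rewrite invfM mulrACA divff ?mul1r// gt_eqF.
have [jensen jensen_eq] := sphere_jensen hphi cf f0 cw w0.
have [XH holder_eq] := sphere_holder P0 cK (fun i u => @K0 i u) cg g0.
rewrite -/X -/J -XE -/H in jensen jensen_eq XH holder_eq.
have [_ _ dphi _ _] := hphi.
have H0 : 0 < H by exact: lt_le_trans XH.
have phiHX : phi (H / J) <= phi (X / J).
  by apply: dphi; rewrite ?in_itv/= ?andbT ?divr_gt0// ler_pM2r ?invr_gt0.
have le_rhs : J * phi (H / J) <= J * phi (X / J) by rewrite ler_pM2l.
split; first by rewrite lhsE rhsE ler_pM2l// (le_trans le_rhs).
move=> sphi; rewrite lhsE rhsE; split=> [/(mulfI (lt0r_neq0 N0)) E|[dL dK]].
  have fE := jensen_eq sphi.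
  (* [J * phi (X / J)] lies between the two equal ends, so the Hoelder and the Jensen steps are both
     equalities. *)
  have jE : J * phi (H / J) = J * phi (X / J).
    by apply/le_anti; rewrite le_rhs -E jensen.
  have {}fE := fE (etrans E jE).
  (* Strict convexity makes [phi] strictly decreasing, so [X < H] would make the Hoelder step
     strict. *)
  have HX : X = H.
    apply/eqP; move: XH; rewrite le_eqVlt => /predU1P[->//|XltH].
    have : phi (H / J) < phi (X / J).
      apply: (strictly_convex_decreasing sphi dphi); first by rewrite divr_gt0.
      by rewrite ltr_pM2r ?invr_gt0.
    by rewrite (mulfI (lt0r_neq0 J0) jE) ltxx.
  have dK (i j : 'I_n.+1) : (i < r)%N -> (j < r)%N -> dilates (K i) (K j).
    by move=> ir jr u v Su Sv; exact: holder_eq.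
  split=> // i ir u v Su Sv.
  (* The comparison of [L1] with [K i] passes through [K ord0], whose ratio to [L1] is the constant
     [X / J]. *)
  have fL z : sphere n.+1 z -> radial L1 z / radial (K i) z =
      (X / J)^-1 * (radial (K ord0) z / radial (K i) z).
    by move=> Sz; rewrite -(fE _ Sz) /f invf_div mulrA divfK ?lt0r_neq0 ?K0.
  by rewrite !fL// (dK ord0 i r0 ir _ _ Su Sv).
(* For the converse the ratios are constant, and their values at one point [u0] supply all the
   constants of proportionality. *)
have [u0 Su0] := @sphere_nonempty R n.
have fc u : sphere n.+1 u -> f u = f u0.
  by move=> Su; have := dL ord0 r0 _ _ Su Su0; rewrite -invf_div -[RHS]invf_div => /invr_inj.
have XJ : X = f u0 * J.
  rewrite -RintegralZl//; last exact: within_continuous_sphere_integrable.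
    by apply: eq_Rintegral => u /set_mem Su; rewrite fc.
  exact: measurable_sphere.
have <- : X = H.
  rewrite XE; apply: (sphere_holder_proportional
    (h := radial (K ord0)) (c := fun i => radial (K i) u0 / radial (K ord0) u0)) => //.
  - by move=> u; exact: K0.
  - by move=> i _; rewrite divr_gt0 ?K0.
  - move=> i u iP Su; rewrite -(dK i ord0 iP r0 u u0 Su Su0) divfK//.
    by rewrite gt_eqF ?K0.
(* With [f] constant, both sides reduce to [J * phi (f u0)]. *)
congr (_ * _); rewrite XJ mulfK ?gt_eqF// mulrC -RintegralZl//.
- by apply: eq_Rintegral => u /set_mem Su; rewrite fc.
- exact: measurable_sphere.
- exact: within_continuous_sphere_integrable.
Qed.
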